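(* Let $R$ be a commutative artinian ring, let $(\mathcal C,\mathbb E,\mathfrak s)$ be an artin extriangulated $R$-category, let $\Theta=\{\Theta(i)\}_{i=1}^{n}$ be a family of objects in $\mathcal C$, and let $\le$ be a linear order on the set $[1,n]=\{1,\dots,n\}$ such that $\mathbb E(\Theta(j),\Theta(i))=0$ for all $j\ge i$. Then the following statements hold. (1) For any object $X\in\mathcal C$, there are two $\mathbb E$-triangles in $\mathcal C$ $$X\to Y_X\to C_X\dashrightarrow\quad\text{with } Y_X\in\mathcal I(\Theta)\text{ and } C_X\in\mathfrak F(\Theta),$$ $$K_X\to Q_X\to X\dashrightarrow\quad\text{with } Q_X\in\mathcal P(\Theta)\text{ and } K_X\in\mathfrak F(\Theta).$$ (2) $\mathcal P(\Theta)$ is a precovering class and $\mathcal I(\Theta)$ is a preenveloping class in $\mathcal C$.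
   Context: **Extriangulated categories (Nakaoka–Palu).** Let $\mathcal C$ be an additive category and $\mathbb E:\mathcal C^{\mathrm{op}}\times\mathcal C\to \mathrm{Ab}$ a biadditive functor. An element $\delta\in\mathbb E(C,A)$ is an $\mathbb E$-extension; for $a:A\to A'$ and $c:C'\to C$ write $a_*\delta=\mathbb E(C,a)(\delta)$, $c^*\delta=\mathbb E(c,A)(\delta)$. For $\delta\in\mathbb E(C,A)$, $\delta'\in\mathbb E(C',A')$, a morphism $(a,c):\delta\to\delta'$ is a pair $a:A\to A'$, $c:C\to C'$ with $a_*\delta=c^*\delta'$; $\delta\oplus\delta'\in\mathbb E(C\oplus C',A\oplus A')$ is the element with components $(\delta,0,0,\delta')$ in $\mathbb E(C,A)\oplus\mathbb E(C,A')\oplus\mathbb E(C',A)\oplus\mathbb E(C',A')$. Sequences $A\xrightarrow{x}B\xrightarrow{y}C$ and $A\xrightarrow{x'}B'\xrightarrow{y'}C$ are equivalent if there is an isomorphism $b:B\to B'$ with $bx=x'$, $y'b=y$; $[A\to B\to C]$ denotes the equivalence class. A realization $\mathfrak s$ assigns to each $\delta\in\mathbb E(C,A)$ a class $\mathfrak s(\delta)=[A\xrightarrow{x}B\xrightarrow{y}C]$ such that for every morphism $(a,c):\delta\to\delta'$, with $\mathfrak s(\delta')=[A'\xrightarrow{x'}B'\xrightarrow{y'}C']$, there is $b:B\to B'$ with $bx=x'a$, $y'b=cy$. It is additive if $\mathfrak s(0)=[A\to A\oplus C\to C]$ (canonical maps) and $\mathfrak s(\delta\oplus\delta')=\mathfrak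 s(\delta)\oplus\mathfrak s(\delta')$. $(\mathcal C,\mathbb E,\mathfrak s)$ is an extriangulated category if: (ET1) $\mathbb E$ is biadditive; (ET2) $\mathfrak s$ is an additive realization; (ET3) if $\mathfrak s(\delta)=[A\xrightarrow{x}B\xrightarrow{y}C]$, $\mathfrak s(\delta')=[A'\xrightarrow{x'}B'\xrightarrow{y'}C']$ and $bx=x'a$, then there is $c:C\to C'$ with $(a,c):\delta\to\delta'$ a morphism and $cy=y'b$; (ET4) if $\delta\in\mathbb E(D,A)$, $\delta'\in\mathbb E(F,B)$ are realized by $A\xrightarrow{f}B\xrightarrow{f'}D$ and $B\xrightarrow{g}C\xrightarrow{g'}F$, there are an object $E$, morphisms $h=gf:A\to C$, $h':C\to E$, $d:D\to E$, $e:E\to F$ with $h'g=df'$, $eh'=g'$, and $\delta''\in\mathbb E(E,A)$ realized by $A\xrightarrow{h}C\xrightarrow{h'}E$, such that $D\xrightarrow{d}E\xrightarrow{e}F$ realizes $f'_*\delta'$, $d^*\delta''=\delta$ and $f_*\delta''=e^*\delta'$; and (ET3)$^{\mathrm{op}}$, (ET4)$^{\mathrm{op}}$, the duals of (ET3), (ET4) (obtained by passing to the opposite category). An $\mathbb E$-triangle $A\to B\to C\dashrightarrow$ is a sequence realizing some $\delta\in\mathbb E(C,A)$. **Artin extriangulated $R$-category.** An extriangulated category which is an $R$-category (Hom sets are $R$-modules, composition is $R$-bilinear), with $\mathbb E$ an $R$-bilinear functor into $R$-modules, such that all $\mathrm{Hom}_{\mathcal C}(X,Y)$ and all $\mathbb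 E(X,Y)$ are finitely generated $R$-modules, and $\mathcal C$ is Krull–Schmidt (every object is a finite direct sum of objects with local endomorphism rings). **Filtered objects.** For a class $\mathcal X$ of objects, $\mathfrak F(\mathcal X)$ is the class of objects $M$ admitting an $\mathcal X$-filtration: a family of $\mathbb E$-triangles $\{M_{i-1}\to M_i\to X_i\dashrightarrow\}_{i=0}^{m}$ with $M_{-1}=0=X_0$, $M_m=M$ and $X_i\in\mathcal X$ for $i\ge1$. **$\Theta$-projectives and $\Theta$-injectives.** $\mathcal P(\Theta):=\{A\in\mathcal C\mid \mathbb E(A,X)=0\text{ for all }X\in\mathfrak F(\Theta)\}$ and $\mathcal I(\Theta):=\{A\in\mathcal C\mid \mathbb E(X,A)=0\text{ for all }X\in\mathfrak F(\Theta)\}$. **Precovering, preenveloping.** An $\mathcal X$-precover of $C$ is a morphism $f:X\to C$ with $X\in\mathcal X$ such that $\mathrm{Hom}_{\mathcal C}(X',X)\to\mathrm{Hom}_{\mathcal C}(X',C)$ is surjective for all $X'\in\mathcal X$; $\mathcal X$ is precovering in $\mathcal C$ if every object of $\mathcal C$ has an $\mathcal X$-precover. $\mathcal X$-preenvelopes and preenveloping classes are defined dually. *)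

(* Defs.v *)
From mathcomp Require Import all_boot all_algebra.

Set Implicit Arguments.
Unset Strict Implicit.
Unset Printing Implicit Defensive.

Import GRing.Theory.
Local Open Scope ring_scope.

Record is_ideal (R : comPzRingType) (I : R -> Prop) : Prop := IsIdeal {
  ideal_0 : I 0;
  ideal_add : forall x y, I x -> I y -> I (x + y);
  ideal_mul : forall r x, I x -> I (r * x)
}.

Definition is_artinian (R : comPzRingType) : Prop :=
  forall I : nat -> R -> Prop,
    (forall k, is_ideal (I k)) ->
    (forall k x, I k.+1 x -> I k x) ->
    exists N, forall k, (N <= k)%N -> forall x, I N x -> I k x.

Definition finitely_generated (R : comPzRingType) (V : lmodType R) : Prop :=
  exists (m : nat) (v : 'I_m -> V),
    forall x, exists r : 'I_m -> R, x = \sum_(k < m) r k *: v k.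

(** [emap c a] is E(c, a) : E(C, A) -> E(C', A').  The class s(delta) is encoded
    by its membership predicate: [realizes delta x y] means that the sequence
    A -x-> B -y-> C belongs to s(delta).  The conditions on the
    data are imposed separately, so that the opposite data involve no proofs. *)
Record extri_data (R : comPzRingType) := ExtriData {
  obj : Type;
  mor : obj -> obj -> lmodType R;
  idm : forall A, mor A A;
  compm : forall A B C, mor B C -> mor A B -> mor A C;
  ext : obj -> obj -> lmodType R;
  emap : forall C C' A A', mor C' C -> mor A A' -> ext C A -> ext C' A';
  realizes : forall C A, ext C A -> forall B, mor A B -> mor B C -> Prop
}.

Arguments mor {R} T A B : rename.
Arguments idm {R T} A : rename.
Arguments compm {R T A B C} g f : rename.
Arguments ext {R} T C A : rename.
Arguments emap {R T C C' A A'} c a d : rename.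
Arguments realizes {R T C A} d {B} x y : rename.

Notation "g \om f" := (compm g f) (at level 40, left associativity).

Definition opposite (R : comPzRingType) (T : extri_data R) : extri_data R :=
  @ExtriData R (obj T) (fun A B => mor T B A) (fun A => idm A)
    (fun A B C g f => f \om g)
    (fun C A => ext T A C)
    (fun C C' A A' c a d => emap a c d)
    (fun C A d B x y => realizes d y x).

Section Structure.
Variables (R : comPzRingType) (T : extri_data R).
Implicit Types A B C D : obj T.

Definition push C A A' (a : mor T A A') (d : ext T C A) : ext T C A' :=
  emap (idm C) a d.

Definition pull C C' A (c : mor T C' C) (d : ext T C A) : ext T C' A :=
  emap c (idm A) d.

Definition is_iso A B (f : mor T A B) : Prop :=
  exists g : mor T B A, g \om f = idm A /\ f \om g = idm B.

Definition is_zero_obj Z : Prop :=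
  forall A, (forall f : mor T A Z, f = 0) /\ (forall f : mor T Z A, f = 0).

Record is_biproduct A B S (i1 : mor T A S) (i2 : mor T B S)
    (p1 : mor T S A) (p2 : mor T S B) : Prop := IsBiproduct {
  biprod_11 : p1 \om i1 = idm A;
  biprod_22 : p2 \om i2 = idm B;
  biprod_12 : p1 \om i2 = 0;
  biprod_21 : p2 \om i1 = 0;
  biprod_sum : i1 \om p1 + i2 \om p2 = idm S
}.

Definition is_direct_sum (m : nat) (X : 'I_m -> obj T) S : Prop :=
  exists (i : forall k, mor T (X k) S) (p : forall k, mor T S (X k)),
    [/\ forall k, p k \om i k = idm (X k),
        forall j k, j != k -> p k \om i j = 0 &
        \sum_(k < m) i k \om p k = idm S].

Record is_linear_category : Prop := IsLinearCategory {
  comp_idl : forall A B (f : mor T A B), idm B \om f = f;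
  comp_idr : forall A B (f : mor T A B), f \om idm A = f;
  comp_assoc : forall A B C D (h : mor T C D) (g : mor T B C) (f : mor T A B),
    h \om (g \om f) = (h \om g) \om f;
  comp_linearr : forall A B C (g : mor T B C),
    linear (fun f : mor T A B => g \om f);
  comp_linearl : forall A B C (f : mor T A B),
    linear (fun g : mor T B C => g \om f)
}.

Record is_additive_category : Prop := IsAdditiveCategory {
  additive_linear : is_linear_category;
  additive_zero : exists Z, is_zero_obj Z;
  additive_biproduct : forall A B, exists S i1 i2 p1 p2,
    @is_biproduct A B S i1 i2 p1 p2
}.

Record is_bilinear_bifunctor : Prop := IsBilinearBifunctor {
  emap_id : forall C A (d : ext T C A), emap (idm C) (idm A) d = d;
  emap_comp : forall C C' C'' A A' A'' (c : mor T C' C) (c' : mor T C'' C')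
      (a : mor T A A') (a' : mor T A' A'') (d : ext T C A),
    emap (c \om c') (a' \om a) d = emap c' a' (emap c a d);
  emap_linear : forall C C' A A' (c : mor T C' C) (a : mor T A A'),
    linear (fun d : ext T C A => emap c a d);
  push_linear : forall C A A' (d : ext T C A),
    linear (fun a : mor T A A' => push a d);
  pull_linear : forall C C' A (d : ext T C A),
    linear (fun c : mor T C' C => pull c d)
}.

Definition ext_morphism C A C' A' (d : ext T C A) (d' : ext T C' A')
    (a : mor T A A') (c : mor T C C') : Prop :=
  push a d = pull c d'.

Definition seq_equiv A C B (x : mor T A B) (y : mor T B C)
    B' (x' : mor T A B') (y' : mor T B' C) : Prop :=
  exists b : mor T B B', [/\ is_iso b, b \om x = x' & y' \om b = y].

Record is_realization : Prop := IsRealization {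
  realizes_class : forall C A (d : ext T C A),
    exists B (x : mor T A B) (y : mor T B C),
    forall B' (x' : mor T A B') (y' : mor T B' C),
      realizes d x' y' <-> seq_equiv x y x' y';
  realizes_morphism : forall C A C' A' (d : ext T C A) (d' : ext T C' A')
      (a : mor T A A') (c : mor T C C')
      B (x : mor T A B) (y : mor T B C) B' (x' : mor T A' B') (y' : mor T B' C'),
    ext_morphism d d' a c -> realizes d x y -> realizes d' x' y' ->
    exists b : mor T B B', b \om x = x' \om a /\ y' \om b = c \om y
}.

(** Direct sums are only defined up to isomorphism; the two conditions are
    required for every choice of biproducts.  [e] is the extension
    [d] (+) [d'], given by its four components. *)
Record is_additive_realization : Prop := IsAdditiveRealization {
  additive_realization : is_realization;
  realizes_0 : forall A C S (i1 : mor T A S) (i2 : mor T C S)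
      (p1 : mor T S A) (p2 : mor T S C),
    is_biproduct i1 i2 p1 p2 -> realizes (0 : ext T C A) i1 p2;
  realizes_sum : forall A B C (d : ext T C A) (x : mor T A B) (y : mor T B C)
      A' B' C' (d' : ext T C' A') (x' : mor T A' B') (y' : mor T B' C')
      SA (iA : mor T A SA) (iA' : mor T A' SA) (pA : mor T SA A) (pA' : mor T SA A')
      SB (iB : mor T B SB) (iB' : mor T B' SB) (pB : mor T SB B) (pB' : mor T SB B')
      SC (iC : mor T C SC) (iC' : mor T C' SC) (pC : mor T SC C) (pC' : mor T SC C')
      (e : ext T SC SA),
    is_biproduct iA iA' pA pA' ->
    is_biproduct iB iB' pB pB' ->
    is_biproduct iC iC' pC pC' ->
    emap iC pA e = d -> emap iC pA' e = 0 ->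
    emap iC' pA e = 0 -> emap iC' pA' e = d' ->
    realizes d x y -> realizes d' x' y' ->
    realizes e (iB \om x \om pA + iB' \om x' \om pA')
               (iC \om y \om pB + iC' \om y' \om pB')
}.

Definition ET3 : Prop :=
  forall C A C' A' (d : ext T C A) (d' : ext T C' A')
      B (x : mor T A B) (y : mor T B C) B' (x' : mor T A' B') (y' : mor T B' C')
      (a : mor T A A') (b : mor T B B'),
    realizes d x y -> realizes d' x' y' -> b \om x = x' \om a ->
    exists c : mor T C C', ext_morphism d d' a c /\ c \om y = y' \om b.

Definition ET4 : Prop :=
  forall A B C D F (d : ext T D A) (d' : ext T F B)
      (f : mor T A B) (f' : mor T B D) (g : mor T B C) (g' : mor T C F),
    realizes d f f' -> realizes d' g g' ->
    exists E (h' : mor T C E) (u : mor T D E) (v : mor T E F) (d'' : ext T E A),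
      [/\ h' \om g = u \om f' /\ v \om h' = g',
          realizes d'' (g \om f) h',
          realizes (push f' d') u v,
          pull u d'' = d &
          push f d'' = pull v d'].

End Structure.

Record is_extriangulated (R : comPzRingType) (T : extri_data R) : Prop :=
  IsExtriangulated {
    extri_additive : is_additive_category T;
    extri_ET1 : is_bilinear_bifunctor T;
    extri_ET2 : is_additive_realization T;
    extri_ET3 : ET3 T;
    extri_ET3op : ET3 (opposite T);
    extri_ET4 : ET4 T;
    extri_ET4op : ET4 (opposite T)
  }.

Section Artin.
Variables (R : comPzRingType) (T : extri_data R).
Implicit Types (A C M X : obj T) (P : obj T -> Prop).

(** The endomorphism ring of [X] is local: it is nonzero and the sum of two
    non-units is a non-unit. *)
Definition has_local_end X : Prop :=
  idm X <> 0 /\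
  forall f g : mor T X X, ~ is_iso f -> ~ is_iso g -> ~ is_iso (f + g).

Definition krull_schmidt : Prop :=
  forall X, exists (m : nat) (Y : 'I_m -> obj T),
    (forall k, has_local_end (Y k)) /\ is_direct_sum Y X.

Record is_artin_extriangulated : Prop := IsArtinExtriangulated {
  artin_extri : is_extriangulated T;
  artin_hom : forall A B, finitely_generated (mor T A B);
  artin_ext : forall C A, finitely_generated (ext T C A);
  artin_krull_schmidt : krull_schmidt
}.

Definition is_triangle A B C (x : mor T A B) (y : mor T B C) : Prop :=
  exists d : ext T C A, realizes d x y.

(** Indices are shifted by one: [N i] stands for M_(i-1). *)
Definition filtered P M : Prop :=
  exists (m : nat) (N X : nat -> obj T),
    [/\ is_zero_obj (N 0%N),
        is_zero_obj (X 0%N),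
        N m.+1 = M,
        forall i, (0 < i <= m)%N -> P (X i) &
        forall i, (i <= m)%N ->
          exists (x : mor T (N i) (N i.+1)) (y : mor T (N i.+1) (X i)),
            is_triangle x y].

Definition family_class n (Theta : 'I_n -> obj T) X : Prop :=
  exists k, X = Theta k.

Definition filt n (Theta : 'I_n -> obj T) : obj T -> Prop :=
  filtered (family_class Theta).

Definition theta_projective n (Theta : 'I_n -> obj T) A : Prop :=
  forall X, filt Theta X -> forall d : ext T A X, d = 0.

Definition theta_injective n (Theta : 'I_n -> obj T) A : Prop :=
  forall X, filt Theta X -> forall d : ext T X A, d = 0.

Definition is_precover P X C (f : mor T X C) : Prop :=
  P X /\ forall X', P X' ->
    forall g : mor T X' C, exists h : mor T X' X, f \om h = g.

Definition precovering P : Prop :=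
  forall C, exists X (f : mor T X C), is_precover P f.

Definition is_preenvelope P C X (f : mor T C X) : Prop :=
  P X /\ forall X', P X' ->
    forall g : mor T C X', exists h : mor T X X', h \om f = g.

Definition preenveloping P : Prop :=
  forall C, exists X (f : mor T C X), is_preenvelope P f.

End Artin.

(* Main.v *)
(** Given a nonzero class d in E(Theta(i), Y), realize it as a triangle
    Y -> Y' -> Theta(i).  Since E(Theta(i), Theta(i)) = 0, the map
    E(Theta(i), Y) -> E(Theta(i), Y') is onto and kills d, so iterating over a
    finite generating set annihilates E(Theta(i), -).  Doing this for i in
    decreasing order never revives a group E(Theta(j), -) with j > i, because
    E(Theta(j), Theta(i)) = 0.  By (ET4) the cone of the composite is an iterated
    extension of Theta's, and iterated extensions are filtered by (ET4)^op.  The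
    second triangle is obtained in the opposite category, and the precovers are
    the deflations Q_X -> X: the obstruction to lifting along them lies in
    E(-, K_X). *)

Require Import Defs.
From mathcomp Require Import all_boot all_algebra.

Set Implicit Arguments.
Unset Strict Implicit.
Unset Printing Implicit Defensive.

Import GRing.Theory.
Local Open Scope ring_scope.

(** [linear f] as a bare proposition, without a packaged morphism. *)
Lemma linear_prop0 (R : pzRingType) (U V : lmodType R) (f : U -> V) :
  linear f -> f 0 = 0.
Proof.
move=> lf; have := lf (-1) 0 0.
by rewrite scaler0 addr0 scaleN1r addNr.
Qed.

Lemma linear_propD (R : pzRingType) (U V : lmodType R) (f : U -> V) x y :
  linear f -> f (x + y) = f x + f y.
Proof. by move=> lf; have := lf 1 x y; rewrite !scale1r. Qed.

Lemma linear_propZ (R : pzRingType) (U V : lmodType R) (f : U -> V) a x :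
  linear f -> f (a *: x) = a *: f x.
Proof. by move=> lf; have := lf a x 0; rewrite !addr0 (linear_prop0 lf) addr0. Qed.

Lemma linear_prop_sum (R : pzRingType) (U V : lmodType R) (f : U -> V)
    m (r : 'I_m -> R) (v : 'I_m -> U) : linear f ->
  f (\sum_(k < m) r k *: v k) = \sum_(k < m) r k *: f (v k).
Proof.
move=> lf; elim/big_rec2: _ => [|k y x _ <-]; first exact: linear_prop0.
by rewrite (linear_propD _ _ lf) (linear_propZ _ _ lf).
Qed.

(** * Zero objects, isomorphisms and biproducts in a linear category *)

Section Linear.
Variables (R : comPzRingType) (T : extri_data R).
Hypothesis hL : is_linear_category T.

Lemma comp0m A B C (f : mor T A B) : (0 : mor T B C) \om f = 0.
Proof. exact: (linear_prop0 (comp_linearl hL (C := C) f)). Qed.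

Lemma compm0 A B C (g : mor T B C) : g \om (0 : mor T A B) = 0.
Proof. exact: (linear_prop0 (comp_linearr hL (A := A) g)). Qed.

Lemma is_iso_idm A : is_iso (idm A : mor T A A).
Proof. by exists (idm A); rewrite !(comp_idl hL). Qed.

Lemma is_iso_comp A B C (g : mor T B C) (f : mor T A B) :
  is_iso g -> is_iso f -> is_iso (g \om f).
Proof.
move=> [g' [g'g gg']] [f' [f'f ff']]; exists (f' \om g'); split.
  by rewrite (comp_assoc hL) -(comp_assoc hL f') g'g (comp_idr hL).
by rewrite (comp_assoc hL) -(comp_assoc hL g) ff' (comp_idr hL).
Qed.

Lemma seq_equiv_sym A C B (x : mor T A B) (y : mor T B C)
    B' (x' : mor T A B') (y' : mor T B' C) :
  seq_equiv x y x' y' -> seq_equiv x' y' x y.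
Proof.
move=> [b [[c [cb bc]] <- <-]]; exists c; split.
- by exists b.
- by rewrite (comp_assoc hL) cb (comp_idl hL).
- by rewrite -(comp_assoc hL) bc (comp_idr hL).
Qed.

Lemma seq_equiv_trans A C B (x : mor T A B) (y : mor T B C)
    B' (x' : mor T A B') (y' : mor T B' C)
    B'' (x'' : mor T A B'') (y'' : mor T B'' C) :
  seq_equiv x y x' y' -> seq_equiv x' y' x'' y'' -> seq_equiv x y x'' y''.
Proof.
move=> [b [hb <- <-]] [c [hc <- <-]]; exists (c \om b); split.
- exact: is_iso_comp.
- by rewrite (comp_assoc hL).
- by rewrite (comp_assoc hL).
Qed.

Lemma idm_zero Z : is_zero_obj Z -> idm Z = 0 :> mor T Z Z.
Proof. by move=> hZ; apply: (proj1 (hZ Z)). Qed.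

Lemma is_zero_obj_idm Z : idm Z = 0 :> mor T Z Z -> is_zero_obj Z.
Proof.
move=> id0 A; split=> f; first by rewrite -(comp_idl hL f) id0 comp0m.
by rewrite -(comp_idr hL f) id0 compm0.
Qed.

Lemma is_zero_obj_iso A B (f : mor T A B) :
  is_iso f -> is_zero_obj A -> is_zero_obj B.
Proof.
move=> [g [_ fg]] hA; apply: is_zero_obj_idm.
by rewrite -fg (proj2 (hA _) f) comp0m.
Qed.

Lemma biproduct_0r A Z : is_zero_obj Z ->
  is_biproduct (idm A) (0 : mor T Z A) (idm A) (0 : mor T A Z).
Proof.
move=> hZ; split; rewrite ?comp0m ?compm0 ?(comp_idl hL) ?addr0 //.
by rewrite (idm_zero hZ).
Qed.

Lemma biproduct_0l A Z : is_zero_obj Z ->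
  is_biproduct (0 : mor T Z A) (idm A) (0 : mor T A Z) (idm A).
Proof.
move=> hZ; split; rewrite ?comp0m ?compm0 ?(comp_idl hL) ?add0r //.
by rewrite (idm_zero hZ).
Qed.

Lemma is_linear_category_opposite : is_linear_category (opposite T).
Proof.
split=> [A B f|A B f|A B C D h g f|A B C g|A B C f] /=.
- exact: (comp_idr hL).
- exact: (comp_idl hL).
- by rewrite /= (comp_assoc hL).
- exact: (comp_linearl hL).
- exact: (comp_linearr hL).
Qed.

End Linear.

(** * Duality *)

Section Opposite.
Variables (R : comPzRingType) (T : extri_data R).

Lemma oppositeK : opposite (opposite T) = T.
Proof. by case: T. Qed.

Lemma is_zero_obj_opposite Z :
  @is_zero_obj R (opposite T) Z <-> @is_zero_obj R T Z.
Proof. by split=> hZ A; case: (hZ A). Qed.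

Lemma is_biproduct_opposite (A B S : obj T) (i1 : mor T A S) (i2 : mor T B S)
    (p1 : mor T S A) (p2 : mor T S B) :
  is_biproduct i1 i2 p1 p2 <-> @is_biproduct R (opposite T) A B S p1 p2 i1 i2.
Proof. by split=> -[]; split. Qed.

Lemma is_iso_opposite (A B : obj T) (f : mor T A B) :
  @is_iso R (opposite T) B A f <-> is_iso f.
Proof. by split=> -[g [gf fg]]; exists g; split. Qed.

(** Dualizing turns the isomorphism of middle terms around, so symmetry of the equivalence is used
    in both directions. *)
Lemma seq_equiv_opposite (A B C B' : obj T) (x : mor T A B) (y : mor T B C)
    (x' : mor T A B') (y' : mor T B' C) : is_linear_category T ->
  @seq_equiv R (opposite T) C A B y x B' y' x' <-> seq_equiv x y x' y'.
Proof.
move=> hL; split.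
  move=> [b [hb e1 e2]]; apply: (seq_equiv_sym hL).
  by exists b; split=> //; apply/is_iso_opposite.
move=> /(seq_equiv_sym hL) [b [hb e1 e2]].
by exists b; split=> //; apply/is_iso_opposite.
Qed.

Lemma is_extriangulated_opposite :
  is_extriangulated T -> is_extriangulated (opposite T).
Proof.
case=> [[hL [Z hZ] hB] h1 [[h2c h2m] h20 h2s] h3 h3o h4 h4o].
(* By [oppositeK], each of (ET3) and (ET4) swaps with its dual, leaving additivity, (ET1) and
   (ET2). *)
split; rewrite ?oppositeK //.
- split; first exact: is_linear_category_opposite.
    by exists Z; apply/is_zero_obj_opposite.
  move=> A B; have [S [i1 [i2 [p1 [p2 h]]]]] := hB A B.
  by exists S, p1, p2, i1, i2; apply/is_biproduct_opposite.
- case: h1 => e1 e2 e3 e4 e5; split.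
  + by move=> C A d; exact: e1.
  + by move=> C C' C'' A A' A'' c c' a a' d; exact: e2.
  + by move=> C C' A A' c a; exact: e3.
  + by move=> C A A' d a; exact: e5.
  + by move=> C C' A d c; exact: e4.
- split; first split.
  + move=> C A d; have [B [x [y h]]] := h2c _ _ d.
    exists B, y, x => B' x' y' /=.
    exact: (iff_trans (h _ _ _) (iff_sym (seq_equiv_opposite _ _ _ _ hL))).
  + move=> C A C' A' d d' a c B x y B' x' y' he hd hd'.
    have [b [e1 e2]] := h2m _ _ _ _ d' d c a _ _ _ _ _ _ (esym he) hd' hd.
    by exists b; split.
  + move=> A C S i1 i2 p1 p2 h /=.
    (* Read in [T], the arrow [p2] is an injection and [i1] a projection, so the two summands
       exchange roles. *)
    apply: (h20 _ _ _ p2 p1 i2 i1).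
    by case: h => ? ? ? ? hs; split=> //; rewrite addrC.
  + move=> A B C d x y A' B' C' d' x' y' SA iA iA' pA pA' SB iB iB' pB pB'
      SC iC iC' pC pC' e bA bB bC e1 e2 e3 e4 hd hd' /=.
    rewrite !(comp_assoc hL).
    by apply: (h2s _ _ _ d y x _ _ _ d' y' x' _ pC pC' iC iC' _ pB pB' iB iB'
      _ pA pA' iA iA' e) => //; apply/is_biproduct_opposite.
Qed.

End Opposite.

(** Unlike [filtered], this closure is visibly self-dual. *)
Inductive ext_closure (R : comPzRingType) (T : extri_data R)
    (P : obj T -> Prop) : obj T -> Prop :=
| ext_closure_zero Z : is_zero_obj Z -> ext_closure P Z
| ext_closure_mem X : P X -> ext_closure P X
| ext_closure_ext A B C (x : mor T A B) (y : mor T B C) :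
    is_triangle x y -> ext_closure P A -> ext_closure P C -> ext_closure P B.

Lemma ext_closure_opposite (R : comPzRingType) (T : extri_data R)
    (P : obj T -> Prop) M :
  @ext_closure R (opposite T) P M <-> @ext_closure R T P M.
Proof.
split; elim=> {M} [Z hZ|X hX|A B C x y hxy _ hA _ hC].
- exact/ext_closure_zero/is_zero_obj_opposite.
- exact: ext_closure_mem.
- exact: (@ext_closure_ext R T P C B A y x hxy).
- exact/ext_closure_zero/is_zero_obj_opposite.
- exact: ext_closure_mem.
- exact: (@ext_closure_ext R (opposite T) P C B A y x hxy).
Qed.

(** * Exactness and lifting in an extriangulated category *)

Section Extriangulated.
Variables (R : comPzRingType) (T : extri_data R).
Hypothesis hT : is_extriangulated T.

Let hL : is_linear_category T := Defs.additive_linear (extri_additive hT).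
Let hE : is_bilinear_bifunctor T := extri_ET1 hT.
Let hR : is_realization T := additive_realization (extri_ET2 hT).

Lemma push0 C A A' (a : mor T A A') : push a (0 : ext T C A) = 0.
Proof. exact: (linear_prop0 (emap_linear hE _ _)). Qed.

Lemma pull0 C C' A (c : mor T C' C) : pull c (0 : ext T C A) = 0.
Proof. exact: (linear_prop0 (emap_linear hE _ _)). Qed.

Lemma push_idm C A (d : ext T C A) : push (idm A) d = d.
Proof. exact: (emap_id hE d). Qed.

Lemma pull_idm C A (d : ext T C A) : pull (idm C) d = d.
Proof. exact: (emap_id hE d). Qed.

Lemma pull_comp C C' C'' A (c : mor T C' C) (c' : mor T C'' C') (d : ext T C A) :
  pull (c \om c') d = pull c' (pull c d).
Proof. by rewrite /pull -(emap_comp hE) (comp_idl hL). Qed.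

Lemma pull_push C C' A A' (c : mor T C' C) (a : mor T A A') (d : ext T C A) :
  pull c (push a d) = push a (pull c d).
Proof.
by rewrite /pull /push -!(emap_comp hE) !(comp_idl hL) !(comp_idr hL).
Qed.

Lemma ext_zero_l Z A (d : ext T Z A) : is_zero_obj Z -> d = 0.
Proof.
move=> hZ; rewrite -(pull_idm d) (idm_zero hZ).
exact: (linear_prop0 (pull_linear hE (C' := Z) d)).
Qed.

Lemma realizesP C A (d : ext T C A) : exists B (x : mor T A B) (y : mor T B C),
  realizes d x y.
Proof.
have [B [x [y h]]] := realizes_class hR d; exists B, x, y; apply/h.
exists (idm B); split; rewrite ?(comp_idl hL) ?(comp_idr hL) //.
exact: is_iso_idm.
Qed.

Lemma realizes_uniq C A (d : ext T C A) B (x : mor T A B) (y : mor T B C)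
    B' (x' : mor T A B') (y' : mor T B' C) :
  realizes d x y -> realizes d x' y' -> seq_equiv x y x' y'.
Proof.
have [B0 [x0 [y0 h]]] := realizes_class hR d.
by move=> /h/(seq_equiv_sym hL) h1 /h; apply: seq_equiv_trans.
Qed.

Lemma realizes_equiv C A (d : ext T C A) B (x : mor T A B) (y : mor T B C)
    B' (x' : mor T A B') (y' : mor T B' C) :
  realizes d x y -> seq_equiv x y x' y' -> realizes d x' y'.
Proof.
have [B0 [x0 [y0 h]]] := realizes_class hR d.
by move=> /h h1 h2; apply/h; apply: (seq_equiv_trans hL h1).
Qed.

Lemma triangle_idm0 A Z : is_zero_obj Z ->
  is_triangle (idm A : mor T A A) (0 : mor T A Z).
Proof.
move=> hZ; exists 0; apply: (realizes_0 (extri_ET2 hT)).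
exact: (biproduct_0r hL _ hZ).
Qed.

Lemma triangle_0idm A Z : is_zero_obj Z ->
  is_triangle (0 : mor T Z A) (idm A : mor T A A).
Proof.
move=> hZ; exists 0; apply: (realizes_0 (extri_ET2 hT)).
exact: (biproduct_0l hL _ hZ).
Qed.

(** Since E(Z, A) = 0, the triangle realizes the same extension as A = A -> 0, and realizations are
    unique up to equivalence. *)
Lemma triangle_zero_iso A B Z (x : mor T A B) (y : mor T B Z) :
  is_zero_obj Z -> is_triangle x y -> is_iso x.
Proof.
move=> hZ [d hd]; have [d' hd'] := triangle_idm0 A hZ.
rewrite (ext_zero_l d' hZ) -(ext_zero_l d hZ) in hd'.
have [b [hb <- _]] := realizes_uniq hd' hd.
by rewrite (comp_idr hL).
Qed.

(** (ET3) extends the square formed by [x] and the identity of B to a morphism into B = B -> 0,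
    whose extension is zero. *)
Lemma push_inflation C A (d : ext T C A) B (x : mor T A B) (y : mor T B C) :
  realizes d x y -> push x d = 0.
Proof.
move=> hd; have [Z hZ] := additive_zero (extri_additive hT).
have [d' hd'] := triangle_idm0 B hZ.
have [c [-> _]] := extri_ET3 hT hd hd' (erefl (idm B \om x)).
by rewrite (ext_zero_l d' hZ) pull0.
Qed.

Lemma realizes0_section C A B (x : mor T A B) (y : mor T B C) :
  realizes (0 : ext T C A) x y -> exists s : mor T C B, y \om s = idm C.
Proof.
move=> hxy; have [S [i1 [i2 [p1 [p2 h]]]]] :=
  additive_biproduct (extri_additive hT) A C.
have [b [_ _ e]] := realizes_uniq (realizes_0 (extri_ET2 hT) h) hxy.
by exists (b \om i2); rewrite (comp_assoc hL) e (biprod_22 h).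
Qed.

(** For a triangle C -> E -> W realizing y_*e = 0, produced by (ET4), a section
    W -> E pulls the extension of E by A back to a preimage of e. *)
Lemma push_exact W A B C (x : mor T A B) (y : mor T B C) (e : ext T W B) :
  is_triangle x y -> push y e = 0 -> exists e' : ext T W A, e = push x e'.
Proof.
move=> [d hd] he; have [G [g [g' hg]]] := realizesP e.
have [E [h' [u [v [d'' [_ _ huv _ hpp]]]]]] := extri_ET4 hT hd hg.
rewrite he in huv; have [s hs] := realizes0_section huv.
by exists (pull s d''); rewrite -pull_push hpp -pull_comp hs pull_idm.
Qed.

(** The obstruction to lifting [g] is g^*d in E(Q', K). Once it vanishes, (id, g) is a morphism from
    the split extension to [d]; its middle map restricted to the summand Q' is the lift. *)
Lemma triangle_lift X K Q (x : mor T K Q) (y : mor T Q X) Q' (g : mor T Q' X) :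
  is_triangle x y -> (forall d : ext T Q' K, d = 0) ->
  exists h : mor T Q' Q, y \om h = g.
Proof.
move=> [d hd] h0; have [S [i1 [i2 [p1 [p2 hS]]]]] :=
  additive_biproduct (extri_additive hT) K Q'.
have [|b [_ e]] := realizes_morphism hR (d := 0) (d' := d) (a := idm K) (c := g)
    _ (realizes_0 (extri_ET2 hT) hS) hd.
  by rewrite /ext_morphism push0 (h0 (pull g d)).
by exists (b \om i2); rewrite (comp_assoc hL) e -(comp_assoc hL) (biprod_22 hS)
  (comp_idr hL).
Qed.

(** * Filtered objects and closure under extensions *)

Section Filtered.
Variable P : obj T -> Prop.

Lemma filtered_ind (Q : obj T -> Prop) :
  (forall Z, is_zero_obj Z -> Q Z) ->
  (forall N M X (x : mor T N M) (y : mor T M X),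
     filtered P N -> Q N -> is_triangle x y -> P X -> Q M) ->
  forall M, filtered P M -> Q M.
Proof.
move=> Q0 QS M [m [N [X [N0 X0 <- hX ht]]]].
suff H i : (i <= m)%N -> Q (N i.+1) by apply: H.
elim: i => [|i IH] lim.
  (* The zeroth triangle has zero ends, so the filtration effectively starts at [N 1], again a zero
     object. *)
  have [x [y hxy]] := ht 0%N lim; apply: Q0.
  exact: (is_zero_obj_iso hL (triangle_zero_iso X0 hxy)).
have [x [y hxy]] := ht _ lim.
apply: QS _ (IH (ltnW lim)) hxy (hX _ _) => //.
exists i, N, X; split=> // j.
  by case/andP=> j0 ji; apply: hX; rewrite j0 (leq_trans ji (ltnW lim)).
by move=> ji; apply: ht; rewrite (leq_trans ji (ltnW lim)).
Qed.

Lemma filtered_zero Z : is_zero_obj Z -> filtered P Z.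
Proof.
move=> hZ; exists 0%N, (fun=> Z), (fun=> Z); split=> //.
  by case.
by move=> i _; exists (idm Z), 0; apply: triangle_idm0.
Qed.

Lemma filtered_step N M X (x : mor T N M) (y : mor T M X) :
  filtered P N -> is_triangle x y -> P X -> filtered P M.
Proof.
move=> [m [F [G [F0 G0 eN hG ht]]]] hxy hX; subst N.
(* With the shifted indexing the old filtration ends at [F m.+1]; M is placed at index m.+2 and its
   factor X at index m.+1. *)
exists m.+1, (fun i => if (i <= m.+1)%N then F i else M),
  (fun i => if (i <= m)%N then G i else X).
split=> //; first by rewrite ltnn.
  move=> i /andP[i0 im]; case: leqP => // im'; by apply: hG; rewrite i0.
move=> i im; rewrite im.
case: (ltngtP i m.+1) im => // [im _|-> _].
  by rewrite -ltnS im; apply: ht.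
by rewrite !ltnn; exists x, y.
Qed.

Lemma filtered_iso A B (f : mor T A B) : is_iso f -> filtered P A -> filtered P B.
Proof.
move=> hf hA; elim/filtered_ind: hA B f hf => {A}.
  by move=> Z hZ B f hf; apply/filtered_zero/(is_zero_obj_iso hL hf).
move=> N M X x y hN _ [d hd] hX B f hf; case: (hf) => g [gf fg].
apply: (filtered_step (x := f \om x) (y := y \om g) hN _ hX).
exists d; apply: (realizes_equiv hd); exists f; split=> //.
by rewrite -(comp_assoc hL) gf (comp_idr hL).
Qed.

(** Induction on the filtration of C. For its last triangle N -> C -> X, (ET4)^op yields triangles E
    -> B -> X and A -> E -> N; the induction hypothesis filters E, and X is the last factor of B. *)
Lemma filtered_ext A B C (x : mor T A B) (y : mor T B C) :
  is_triangle x y -> filtered P A -> filtered P C -> filtered P B.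
Proof.
move=> hxy hA hC; elim/filtered_ind: hC A B x y hxy hA => {C}.
  by move=> Z hZ A B x y /(triangle_zero_iso hZ); apply: filtered_iso.
move=> N C X f g _ IH [d hd] hX A B x y [e he] hA.
have [E [h' [u [v [d'' [_ hB hE' _ _]]]]]] :=
  extri_ET4op hT (d := d) (d' := e) hd he.
apply: (filtered_step (x := h') (y := g \om y)) hX; last by exists d''.
by apply: (IH _ _ v u) hA; eexists; exact: hE'.
Qed.

(** This lets statements about filtrations, which are built from one side only, pass to the opposite
    category. *)
Lemma filtered_ext_closure M : filtered P M <-> ext_closure P M.
Proof.
split.
  elim/filtered_ind => {M} [Z|N M X x y _ hN hxy hX].
    exact: ext_closure_zero.
  by apply: (ext_closure_ext hxy) => //; apply: ext_closure_mem.
elim=> {M} [Z|X hX|A B C x y hxy _ hA _ hC].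
- exact: filtered_zero.
- have [Z hZ] := additive_zero (extri_additive hT).
  exact: (filtered_step (filtered_zero hZ) (triangle_0idm X hZ) hX).
- exact: (filtered_ext hxy hA hC).
Qed.

(** (ET4) gives the composite a cone E sitting in a triangle C -> E -> C'. *)
Lemma triangle_closure_trans X Y Y' C C' (x : mor T X Y) (y : mor T Y C)
    (x' : mor T Y Y') (y' : mor T Y' C') :
  is_triangle x y -> is_triangle x' y' -> ext_closure P C -> ext_closure P C' ->
  exists E (h : mor T Y' E), is_triangle (x' \om x) h /\ ext_closure P E.
Proof.
move=> [d hd] [d' hd'] hC hC'.
have [E [h [u [v [d'' [_ h1 h2 _ _]]]]]] := extri_ET4 hT hd hd'.
exists E, h; split; first by exists d''.
by apply: (ext_closure_ext (x := u) (y := v)) => //; eexists; exact: h2.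
Qed.

End Filtered.

(** * Annihilating the groups E(Theta(i), -) *)

(** Induction on the number of generators, with Y varying; [S] collects the indices already treated,
    whose vanishing must survive. *)
Lemma kill_generators (I : Type) (Theta : I -> obj T) (P : obj T -> Prop)
    (P_Theta : forall i, P (Theta i)) i (S : I -> Prop) m Y
    (v : 'I_m -> ext T (Theta i) Y) :
  (forall d : ext T (Theta i) (Theta i), d = 0) ->
  (forall j, S j -> forall d : ext T (Theta j) (Theta i), d = 0) ->
  (forall j, S j -> forall d : ext T (Theta j) Y, d = 0) ->
  (forall d, exists r : 'I_m -> R, d = \sum_(k < m) r k *: v k) ->
  exists Y' C (x : mor T Y Y') (y : mor T Y' C),
    [/\ is_triangle x y, ext_closure P C,
        forall d : ext T (Theta i) Y', d = 0 &
        forall j, S j -> forall d : ext T (Theta j) Y', d = 0].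
Proof.
move=> ii Si; elim: m Y v => [|m IH] Y v SY hv.
  have [Z hZ] := additive_zero (extri_additive hT).
  exists Y, Z, (idm Y), 0; split=> //; first exact: triangle_idm0.
    exact: ext_closure_zero.
  by move=> d; have [r ->] := hv d; rewrite big_ord0.
have [Y1 [x1 [y1 h1]]] := realizesP (v ord0).
have t1 : is_triangle x1 y1 by exists (v ord0).
have [|d|Y' [C [x [y [t hC iY' SY']]]]] :=
    (* The first generator dies in E(Theta(i), Y1), so the images of the others must generate it. *)
    IH Y1 (fun k => push x1 (v (lift ord0 k))).
- move=> j Sj d; have [e ->] := push_exact t1 (Si j Sj (push y1 d)).
  by rewrite (SY j Sj e) push0.
(* Self-orthogonality of Theta(i) makes pushing along [x1] surjective, so generators of E(Theta(i),
   Y) map to generators. *)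
- have [e ->] := push_exact t1 (ii (push y1 d)).
  have [r ->] := hv e; exists (fun k => r (lift ord0 k)).
  rewrite /push (linear_prop_sum _ _ (emap_linear hE _ _)) big_ord_recl.
  by rewrite -/(push x1 (v ord0)) (push_inflation h1) scaler0 add0r.
have [E [h [tE hEc]]] :=
  triangle_closure_trans t1 t (ext_closure_mem (P_Theta i)) hC.
by exists Y', E, (x \om x1), h.
Qed.

Lemma orthogonal_coresolution (n : nat) (Theta : 'I_n -> obj T) (le : rel 'I_n) X :
  (forall C A, finitely_generated (ext T C A)) ->
  transitive le -> total le ->
  (forall i j, le i j -> forall d : ext T (Theta j) (Theta i), d = 0) ->
  exists Y C (x : mor T X Y) (y : mor T Y C),
    [/\ is_triangle x y, ext_closure (family_class Theta) C &
        forall j (d : ext T (Theta j) Y), d = 0].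
Proof.
move=> fg le_tr le_tot hTheta.
(* Vanishing is required only on a sorted list, so that induction on the list treats its tail, the
   larger indices, before its head. *)
suff [Y [C [x [y [t hC hY]]]]] : exists Y C (x : mor T X Y) (y : mor T Y C),
    [/\ is_triangle x y, ext_closure (family_class Theta) C &
        forall j, j \in sort le (enum 'I_n) ->
        forall d : ext T (Theta j) Y, d = 0].
  exists Y, C, x, y; split=> // j; apply: hY.
  by rewrite mem_sort mem_enum.
have := sort_sorted le_tot (enum 'I_n).
elim: (sort _ _) => [_|i s IH hs].
  have [Z hZ] := additive_zero (extri_additive hT).
  exists X, Z, (idm X), 0; split=> //; first exact: triangle_idm0.
  exact: ext_closure_zero.
have [Y [C [x [y [t hC hY]]]]] := IH (path_sorted hs).
have [m [v hv]] := fg (Theta i) Y.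
have le_is := allP (order_path_min le_tr hs).
have [|j /le_is/hTheta //|Y' [C' [x' [y' [t' hC' iY' sY']]]]] :=
  kill_generators (P := family_class Theta) (S := fun j => j \in s)
    (fun k => ex_intro _ k erefl) _ _ hY hv.
  by apply: hTheta; case/orP: (le_tot i i).
have [E [h [tE hE']]] := triangle_closure_trans t t' hC hC'.
exists Y', E, (x' \om x), h; split=> // j.
by rewrite inE => /predU1P[->|/sY'].
Qed.

(** E(A, -) is exact in the middle on triangles, so vanishing at both ends forces vanishing in the
    middle. *)
Lemma ext_closure_orthogonal (P : obj T -> Prop) A :
  (forall X, P X -> forall d : ext T A X, d = 0) ->
  forall M, ext_closure P M -> forall d : ext T A M, d = 0.
Proof.
move=> hP M; elim=> {M} [Z hZ d|X /hP //|B C D x y t _ hB _ hD d].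
  by rewrite -(push_idm d) (idm_zero hZ) (linear_prop0 (push_linear hE d)).
by have [e ->] := push_exact t (hD (push y d)); rewrite (hB e) push0.
Qed.

End Extriangulated.

(** * Approximation by Theta-projectives and Theta-injectives *)

Section ThetaOrthogonal.
Variables (R : comPzRingType) (T : extri_data R) (n : nat) (Theta : 'I_n -> obj T).
Hypothesis hT : is_extriangulated T.
Hypothesis fg : forall C A : obj T, finitely_generated (ext T C A).
Variable le : rel 'I_n.
Hypotheses (le_tr : transitive le) (le_tot : total le).
Hypothesis hTheta : forall i j : 'I_n, le i j ->
  forall d : ext T (Theta j) (Theta i), d = 0.

Let hTop := is_extriangulated_opposite hT.

Lemma theta_projectiveP A :
  (forall i (d : ext T A (Theta i)), d = 0) -> theta_projective Theta A.
Proof.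
move=> hA M /(filtered_ext_closure hT); apply: ext_closure_orthogonal => //.
by move=> X [k ->].
Qed.

(** Orthogonality in the first variable is orthogonality in the second one over the opposite
    category, where the extension closure is the same. *)
Lemma theta_injectiveP A :
  (forall i (d : ext T (Theta i) A), d = 0) -> theta_injective Theta A.
Proof.
move=> hA M /(filtered_ext_closure hT) hM.
apply: (ext_closure_orthogonal hTop (P := family_class Theta)).
  by move=> X [k ->]; apply: hA.
exact/ext_closure_opposite.
Qed.

Lemma theta_injective_triangle X : exists Y C (x : mor T X Y) (y : mor T Y C),
  [/\ is_triangle x y, theta_injective Theta Y & filt Theta C].
Proof.
have [Y [C [x [y [t hC hY]]]]] :=
  orthogonal_coresolution hT X fg le_tr le_tot hTheta.
exists Y, C, x, y; split=> //; first exact: theta_injectiveP.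
exact/filtered_ext_closure.
Qed.

Lemma theta_projective_triangle X : exists K Q (x : mor T K Q) (y : mor T Q X),
  [/\ is_triangle x y, theta_projective Theta Q & filt Theta K].
Proof.
have [|||Q [K [y [x [t hK hQ]]]]] :=
  (* Dualizing swaps the arguments of E, so the orthogonality hypothesis holds in the opposite
     category for the reversed order. *)
  @orthogonal_coresolution _ _ hTop n Theta (fun i j => le j i) X
    (fun C A => fg A C).
- by move=> j i k ij jk; apply: le_tr jk ij.
- by move=> i j; apply: le_tot.
- by move=> i j; apply: hTheta.
exists K, Q, x, y; split=> //; first exact: theta_projectiveP.
exact/(filtered_ext_closure hT)/ext_closure_opposite.
Qed.

Lemma precovering_theta_projective : precovering (theta_projective Theta).
Proof.
move=> X; have [K [Q [x [y [t hQ hK]]]]] := theta_projective_triangle X.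
exists Q, y; split=> // Q' hQ' g.
exact: (triangle_lift hT g t (hQ' K hK)).
Qed.

Lemma preenveloping_theta_injective : preenveloping (theta_injective Theta).
Proof.
move=> X; have [Y [C [x [y [t hY hC]]]]] := theta_injective_triangle X.
exists Y, x; split=> // Y' hY' g.
(* Extending [g] along [x] is a lifting problem in the opposite category; its obstruction lies in
   E(C, Y'), zero since C is filtered. *)
exact: (triangle_lift hTop (x := y) (y := x) g t (hY' C hC)).
Qed.

End ThetaOrthogonal.

Theorem theorem3p17 (R : comPzRingType) (hR : is_artinian R)
    (T : extri_data R) (hT : is_artin_extriangulated T)
    (n : nat) (Theta : 'I_n -> obj T)
    (le : rel 'I_n) (hle_refl : reflexive le) (hle_antisym : antisymmetric le)
    (hle_trans : transitive le) (hle_total : total le)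
    (hTheta : forall i j : 'I_n, le i j ->
       forall d : ext T (Theta j) (Theta i), d = 0) :
  (forall X : obj T,
     (exists (Y C : obj T) (x : mor T X Y) (y : mor T Y C),
        [/\ is_triangle x y, theta_injective Theta Y & filt Theta C]) /\
     (exists (K Q : obj T) (x : mor T K Q) (y : mor T Q X),
        [/\ is_triangle x y, theta_projective Theta Q & filt Theta K])) /\
  (precovering (theta_projective Theta) /\ preenveloping (theta_injective Theta)).
Proof.
case: hT => hX _ fg _; split.
  move=> X; split.
    exact: (theta_injective_triangle hX fg hle_trans hle_total hTheta).
  exact: (theta_projective_triangle hX fg hle_trans hle_total hTheta).
split.
  exact: (precovering_theta_projective hX fg hle_trans hle_total hTheta).
exact: (preenveloping_theta_injective hX fg hle_trans hle_total hTheta).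
Qed.
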